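(* Let $\vec N$ be a tree set of bipartitions of a set $X$ such that (a) for all distinct $x,y\in X$ there exists $(A,B)\in\vec N$ with $x\in A$ and $y\in B$; (b) for every consistent orientation $O$ of $\vec N$ there exists $x\in X$ with $O=\{(A,B)\in\vec N: x\in B\}$. Let $\tau$ be a tree set and $g:\vec N\to\tau$ an isomorphism of tree sets, and let $f:\tau\to\vec{\mathcal N}(\tau)$, $f(\vec s)=(\mathcal O_{\overleftarrow s},\mathcal O_{\vec s})$. Then there is a bijection $h:X\to\mathcal O(\tau)$ whose natural action on $\vec N$, namely $(A,B)\mapsto(h(A),h(B))$, equals $f\circ g$. In particular, this action is an isomorphism of tree sets from $\vec N$ to $\vec{\mathcal N}(\tau)$.
   Context: A separation system $(\vec S,\le,{}^* )$ is a poset with an order-reversing involution; write $\overleftarrow s=\vec s^{\,*}$, $s=\{\vec s,\overleftarrow s\}$. $\vec s$ is degenerate if $\vec s=\overleftarrow s$, small if $\vec s\le\overleftarrow s$, trivial if there is a separation $t$ with $\vec s<\vec t$ and $\vec s<\overleftarrow t$. Essential: no trivial and no degenerate elements; nested: any two separations have comparable orientations. A tree set is a nested essential separation system; an isomorphism of tree sets is an order isomorphism commuting with the involutions. An orientation contains exactly one of $\vec s,\overleftarrow s$ for each separation $s$; it is consistent if there are no distinct separations $r\ne s$ with orientations $\vec r<\vec s$ and $\overleftarrow r,\vec s$ both in it. $\mathcal O(\tau)$ is the set of consistent orientations of $\tau$, and $\mathcal O_{\vec s}=\{O\in\mathcal O(\tau):\vec s\in O\}$. A bipartition of $X$ is an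 ordered pair $(A,B)$ of disjoint nonempty sets with union $X$; these form a separation system $\vec S(X)$ under $(A,B)\le(C,D)\iff A\subseteq C$ and $(A,B)^*=(B,A)$. A tree set of bipartitions of $X$ is an involution-closed subset of $\vec S(X)$ that is a tree set with the induced structure. $\vec{\mathcal N}(\tau)$ is the image of $f$ in $\vec S(\mathcal O(\tau))$. *)

(* Defs.v *)
From HB Require Import structures.
From mathcomp Require Import all_boot all_order.
From mathcomp Require Import boolp classical_sets.

Set Implicit Arguments.
Unset Strict Implicit.
Unset Printing Implicit Defensive.
Import Order.TTheory.

Local Open Scope order_scope.
Local Open Scope classical_set_scope.

HB.mixin Record isSepSystem (d : Order.disp_t) T of Order.POrder d T := {
  sinv : T -> T;
  sinvK : involutive sinv;
  sinv_le : forall s t : T, s <= t -> sinv t <= sinv s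
}.

#[short(type="sepSystemType")]
HB.structure Definition SepSystem (d : Order.disp_t) :=
  {T of isSepSystem d T & Order.POrder d T}.

Section SepSystemNotions.
Context {d : Order.disp_t} {T : sepSystemType d}.
Implicit Types (r s t : T) (O : set T).

Definition separation s : set T := [set s; sinv s].

Definition degenerate s := s = sinv s.

Definition trivial s := exists t, s < t /\ s < sinv t.

(* Unique existence of an element, not an exclusive or, so that a degenerate s
   is still allowed (and then has to lie in O). *)
Definition orientation O :=
  forall s, exists! r, (O `&` separation s) r.

Definition consistent O :=
  forall r s, separation r <> separation s -> r < s -> ~ (O (sinv r) /\ O s).

End SepSystemNotions.

Section TreeSets.
Context {d : Order.disp_t} (T : sepSystemType d).

Definition essential := forall s : T, ~ trivial s /\ ~ degenerate s.

Definition nested := forall r s : T,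
  exists r' s', [/\ separation r r', separation s s' & r' >=< s'].

Definition tree_set := nested /\ essential.

Definition consistent_orientations : set (set T) :=
  [set O | orientation O /\ consistent O].

Definition orientations_containing (s : T) : set consistent_orientations :=
  [set O | val O s].

End TreeSets.

Arguments consistent_orientations {d} T.

Definition tree_set_iso {d d' : Order.disp_t}
    {S : sepSystemType d} {T : sepSystemType d'} (g : S -> T) :=
  [/\ bijective g, {mono g : x y / x <= y} & {morph g : x / sinv x}].

Definition sinv_closed {d : Order.disp_t} {T : sepSystemType d} (N : set T) :=
  forall s, N s -> N (sinv s).

(* The closure proof is a phantom argument: it allows the involution of the
   induced separation system to be inferred. *)
Definition subsystem {d : Order.disp_t} {T : sepSystemType d} {N : set T}
  of sinv_closed N : Type := {s : T | s \in N}.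

Section Subsystem.
Context {d : Order.disp_t} {T : sepSystemType d} {N : set T}.
Variable NC : sinv_closed N.

HB.instance Definition _ := SubType.on (subsystem NC).
HB.instance Definition _ := [Choice of subsystem NC by <:].
HB.instance Definition _ := [SubChoice_isSubPOrder of subsystem NC by <: with d].

Definition subsystem_elt (s : T) (Ns : N s) : subsystem NC :=
  exist _ s (mem_set Ns).

Definition subsystem_inv (s : subsystem NC) : subsystem NC :=
  subsystem_elt (NC (set_mem (valP s))).

Lemma subsystem_invK : involutive subsystem_inv.
Proof. by move=> s; apply: val_inj; rewrite /= sinvK. Qed.

Lemma subsystem_inv_le (s t : subsystem NC) :
  s <= t -> subsystem_inv t <= subsystem_inv s.
Proof. by rewrite -!Order.le_val /=; exact: sinv_le. Qed.

HB.instance Definition _ :=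
  isSepSystem.Build d (subsystem NC) subsystem_invK subsystem_inv_le.

End Subsystem.

Record bipartition (X : Type) := Bipartition {
  bipl : set X;
  bipr : set X;
  bip_disj : bipl `&` bipr = set0;
  bip_cover : bipl `|` bipr = setT;
  bipl_neq0 : bipl !=set0;
  bipr_neq0 : bipr !=set0
}.

HB.instance Definition _ X := gen_eqMixin (bipartition X).
HB.instance Definition _ X := gen_choiceMixin (bipartition X).

Fact bip_display : Order.disp_t. Proof. by []. Qed.

Section Bipartitions.
Context {X : Type}.
Implicit Types p q : bipartition X.

Lemma bip_eq p q : bipl p = bipl q -> bipr p = bipr q -> p = q.
Proof.
case: p q => [A B a b c e] [A' B' a' b' c' e'] /= eA eB; subst A' B'.
by congr Bipartition; apply: Prop_irrelevance.
Qed.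

Lemma biprE p : bipr p = ~` bipl p.
Proof.
apply/seteqP; split => x /=.
  by move=> rx lx; have : (bipl p `&` bipr p) x by []; rewrite bip_disj.
by have : setT x by []; rewrite -(bip_cover p) => -[].
Qed.

Definition bip_le p q : bool := `[< bipl p `<=` bipl q >].

Lemma bip_le_refl : reflexive bip_le.
Proof. by move=> p; apply/asboolP. Qed.

Lemma bip_le_anti : antisymmetric bip_le.
Proof.
move=> p q /andP[/asboolP pq /asboolP qp].
have e : bipl p = bipl q by apply/seteqP.
by apply: bip_eq => //; rewrite !biprE e.
Qed.

Lemma bip_le_trans : transitive bip_le.
Proof.
by move=> q p r /asboolP pq /asboolP qr; apply/asboolP; exact: subset_trans qr.
Qed.

HB.instance Definition _ := Order.Le_isPOrder.Build bip_display (bipartition X)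
  bip_le_refl bip_le_anti bip_le_trans.

Definition bip_inv p : bipartition X :=
  Bipartition (etrans (setIC _ _) (bip_disj p))
    (etrans (setUC _ _) (bip_cover p)) (bipr_neq0 p) (bipl_neq0 p).

Lemma bip_invK : involutive bip_inv.
Proof. by move=> p; apply: bip_eq. Qed.

Lemma bip_inv_le p q : p <= q -> bip_inv q <= bip_inv p.
Proof.
move=> /asboolP pq; apply/asboolP; rewrite /= !biprE.
by apply: subsetC.
Qed.

HB.instance Definition _ :=
  isSepSystem.Build bip_display (bipartition X) bip_invK bip_inv_le.

End Bipartitions.

Section BipartitionImage.
Context {X Y : Type} {h : X -> Y} (hbij : bijective h).

Lemma bip_image_disj (p : bipartition X) :
  (h @` bipl p) `&` (h @` bipr p) = set0.
Proof.
rewrite -subset0 => _ [[x px <-] [y py /(bij_inj hbij) yx]].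
rewrite yx in py.
by have : (bipl p `&` bipr p) x by []; rewrite bip_disj.
Qed.

Lemma bip_image_cover (p : bipartition X) :
  (h @` bipl p) `|` (h @` bipr p) = setT.
Proof.
rewrite -image_setU bip_cover; apply/seteqP; split=> // y _.
by case: hbij => k _ kK; exists (k y).
Qed.

Definition bip_image (p : bipartition X) : bipartition Y :=
  Bipartition (bip_image_disj p) (bip_image_cover p)
    (image_nonempty h (bipl_neq0 p)) (image_nonempty h (bipr_neq0 p)).

End BipartitionImage.

Section TreeSetToBipartitions.
Context {d : Order.disp_t} {T : sepSystemType d} (TT : tree_set T).
Implicit Types (r s t : T) (P : set T).

Lemma sinvI s t : sinv s = sinv t -> s = t.
Proof. exact: (can_inj sinvK). Qed.

Lemma sinv_lt s t : s < t -> sinv t < sinv s.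
Proof.
rewrite !lt_neqAle => /andP[st /sinv_le ->]; rewrite andbT.
by apply: contra st => /eqP /sinvI ->.
Qed.

Lemma sepV s : separation (sinv s) = separation s.
Proof. by rewrite /separation sinvK setUC. Qed.

Lemma sep_eqP r s : separation r = separation s <-> r = s \/ r = sinv s.
Proof.
split=> [e|[->|->]//]; last exact: sepV.
have : separation r r by left.
by rewrite e => -[->|->]; [left|right].
Qed.

(* [clash r s]: no consistent orientation contains both r and s. A maximal
   clash-free set containing s is a consistent orientation, which shows that
   both sides of [orientation_bip s] are nonempty. *)
Definition clash r s :=
  s = sinv r \/ (separation r <> separation s /\ sinv r < s).

Lemma clash_sym r s : clash r s -> clash s r.
Proof.
case=> [->|[ne lt]]; first by left; rewrite sinvK.
by right; split; [exact/nesym | move/sinv_lt: lt; rewrite sinvK].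
Qed.

Definition free P := forall r s, P r -> P s -> ~ clash r s.

Lemma clash_self s : ~ clash s s.
Proof.
by case=> [e|[]//]; have [_ /(_ s)[_]] := TT; apply.
Qed.

Lemma not_clash_addP P r : free P -> ~ free (P `|` [set r]) ->
  exists2 q, P q & clash r q.
Proof.
move=> fP; apply: contra_notP => H a b [Pa|->] [Pb|->].
- exact: fP.
- by move=> /clash_sym c; apply: H; exists a.
- by move=> c; apply: H; exists b.
- exact: clash_self.
Qed.

Lemma free_extend s : exists P, [/\ P s, free P &
  forall r, P r \/ P (sinv r)].
Proof.
have [F AF tF|P [fP maxP]] := @Zorn_bigcup T [set P | free (P `|` [set s])].
  move=> a b aF bF.
  suff [Q fQ [Qa Qb]] : exists2 Q : set T, free (Q `|` [set s]) &
      (Q `|` [set s]) a /\ (Q `|` [set s]) b by exact: fQ.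
  have fs : free (set0 `|` [set s]).
    by move=> x y [[]|->] [[]|->]; exact: clash_self.
  case: aF => [[A FA Aa]|->]; case: bF => [[B FB Bb]|->].
  - case: (tF A B FA FB) => AB.
    + by exists B; [exact: AF | split; left => //; exact: AB].
    + by exists A; [exact: AF | split; left => //; exact: AB].
  - by exists A; [exact: AF | split; [left|right]].
  - by exists B; [exact: AF | split; [right|left]].
  - by exists set0 => //; split; right.
set Q := P `|` [set s] in fP.
exists Q; split=> //; first by right.
have maxQ r : ~ Q r -> exists2 q, Q q & clash r q.
  move=> Qr; apply: not_clash_addP => // fQr.
  apply: (maxP (P `|` [set r])).
    split; first by move=> ? ?; left.
    by move=> /(_ r) H; apply: Qr; left; apply: H; right.
  by rewrite /= setUAC.
move=> r; apply: contrapT => /not_orP[nr nr'].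
have [q Qq [qE|[qr rq]]] := maxQ _ nr; first by rewrite qE in Qq.
have [q' Qq' [q'E|[q'r rq']]] := maxQ _ nr'.
  by rewrite sinvK in q'E; rewrite q'E in Qq'.
rewrite sinvK in rq'; rewrite sepV in q'r.
have qr' : sinv q < r by move/sinv_lt: rq; rewrite sinvK.
have [/sep_eqP[e|e]|ne] := pselect (separation q = separation q').
- have [_ /(_ (sinv q))[+ _]] := TT; apply; exists r; split => //.
  by apply: sinv_lt; rewrite e.
- by apply: (fP _ _ Qq Qq'); left; rewrite e sinvK.
- by apply: (fP _ _ Qq Qq'); right; split => //; exact: lt_trans rq'.
Qed.

Lemma orientations_containing_neq0 s : orientations_containing s !=set0.
Proof.
have [P [Ps fP totP]] := free_extend s.
suff PO : consistent_orientations T P by exists (exist _ P (mem_set PO)).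
split=> [r|r t ne rt [Pr Pt]]; last first.
  by apply: (fP _ _ Pr Pt); right; rewrite sepV sinvK.
have nP t : P t -> ~ P (sinv t) by move=> Pt Pt'; apply: (fP _ _ Pt Pt'); left.
have [Pr|Pr] := totP r.
- exists r; split; first by split; [|left].
  by move=> t [Pt [->//|tE]]; case: (nP _ Pr); rewrite -tE.
- exists (sinv r); split; first by split; [|right].
  by move=> t [Pt [tE|->//]]; case: (nP _ Pt); rewrite tE.
Qed.

Lemma orientations_containingC s :
  orientations_containing s = ~` orientations_containing (sinv s).
Proof.
have [_ /(_ s)[_ nd]] := TT.
apply/seteqP; split=> -[O HO] /=; have [oO _] := set_mem HO;
  have [r [[Or sr] ru]] := oO s.
- move=> Os Os'; apply: nd.
  have rs : r = s by apply: ru; split; [|left].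
  have rs' : r = sinv s by apply: ru; split; [|right].
  by rewrite /degenerate -rs' rs.
- by case: sr => [<-//|re]; rewrite -re.
Qed.

Lemma orientations_containing_disj s :
  orientations_containing (sinv s) `&` orientations_containing s = set0.
Proof. by rewrite (orientations_containingC s) setICr. Qed.

Lemma orientations_containing_cover s :
  orientations_containing (sinv s) `|` orientations_containing s = setT.
Proof. by rewrite (orientations_containingC s) setUCr. Qed.

Definition orientation_bip s : bipartition (consistent_orientations T) :=
  Bipartition (orientations_containing_disj s) (orientations_containing_cover s)
    (orientations_containing_neq0 (sinv s)) (orientations_containing_neq0 s).

Definition orientation_bips : set (bipartition (consistent_orientations T)) :=
  range orientation_bip.

Lemma orientation_bips_closed : sinv_closed orientation_bips.
Proof.
move=> _ [s _ <-]; exists (sinv s) => //.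
by apply: bip_eq => //=; rewrite sinvK.
Qed.

End TreeSetToBipartitions.

Arguments orientation_bips_closed {d T} TT.

(* Main.v *)
Require Import Defs.
From mathcomp Require Import all_boot all_order.
From mathcomp Require Import boolp classical_sets.

Import Order.TTheory.

Local Open Scope order_scope.
Local Open Scope classical_set_scope.

(** A point [x] of [X] orients every bipartition in [N] towards the side
    containing [x], and the resulting orientation is consistent because
    [A `<=` C] rules out that [x] lies both in [A] and in the complement of [C].
    Pushing these orientations
    forward along [g] gives [h]; it is injective by (a) and surjective by (b).
    The map [f] need not preserve the order on a tree set with small elements:
    that [f \o g] does so is read off from its being the natural action of the
    bijection [h]. *)

Lemma inj_surj_bijective (A B : Type) (f : A -> B) :
  injective f -> (forall b, exists a, f a = b) -> bijective f.
Proof.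
move=> finj /choice[k kK].
by exists k => // a; apply: finj; rewrite kK.
Qed.

Section TreeSetIso.
Context {d d' : Order.disp_t} {S : sepSystemType d} {T : sepSystemType d'}.
Implicit Types (g : S -> T) (k : T -> S).

Lemma tree_set_iso_can g k :
  cancel g k -> cancel k g -> tree_set_iso g -> tree_set_iso k.
Proof.
move=> gK kK [gbij gmono ginv]; split; first by exists g.
- by move=> x y; rewrite -gmono !kK.
- by move=> x; apply: (can_inj gK); rewrite ginv !kK.
Qed.

Lemma separation_preimage g (s : S) : tree_set_iso g ->
  g @^-1` separation (g s) = separation s.
Proof.
move=> [/bij_inj ginj _ ginv]; rewrite /separation -ginv.
by apply/seteqP; split=> t /= [] => [/ginj|/ginj|->|->]; by [left|right].
Qed.

(** An isomorphism matches separations with separations, so unique choice and distinctness carry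
    over. It serves both ways: along the inverse of [g] to define [h], along [g] itself to show [h]
    surjective. *)
Lemma consistent_orientations_preimage g (O : set T) : tree_set_iso g ->
  consistent_orientations T O -> consistent_orientations S (g @^-1` O).
Proof.
move=> giso [oO cO]; have [[k gK kK] gmono ginv] := giso; split=> [s|r s ne rs].
- have [r [[Or sr] ru]] := oO (g s); exists (k r); split.
    by rewrite -(separation_preimage g s giso); split; rewrite /= kK.
  move=> t [/= Ot]; rewrite -(separation_preimage g s giso) /= => st.
  by rewrite (ru (g t)) // gK.
- rewrite /= ginv; apply: cO; last by rewrite (leW_mono gmono).
  by move=> e; apply: ne; rewrite -!(separation_preimage g _ giso) e.
Qed.

(** Comparable orientations are pushed forward along [g], whereas a trivial or degenerate element of
    [T] would be pulled back to one of [S]. *)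
Lemma tree_set_transport g : tree_set_iso g -> tree_set S -> tree_set T.
Proof.
move=> giso [nS eS]; have [[k gK kK] gmono ginv] := giso.
have [_ kmono kinv] := tree_set_iso_can _ _ gK kK giso.
split=> [r s|s].
- have [r' [s' [rr' ss' cmp]]] := nS (k r) (k s).
  rewrite -(separation_preimage g _ giso) /= kK in rr'.
  rewrite -(separation_preimage g _ giso) /= kK in ss'.
  exists (g r'), (g s'); split=> //.
  by rewrite /Order.comparable !gmono.
- have [nt nd] := eS (k s); split=> [[t [st st']]|e].
    by apply: nt; exists (k t); rewrite -kinv !(leW_mono kmono).
  by apply: nd; rewrite /degenerate -kinv -e.
Qed.

End TreeSetIso.

Section BipartitionPoints.
Context {X : Type} {N : set (bipartition X)} (NC : sinv_closed N).

Lemma biplE (p : bipartition X) : bipl p = ~` bipr p.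
Proof. by rewrite biprE setCK. Qed.

Lemma point_orientation (x : X) :
  consistent_orientations (subsystem NC) [set p | bipr (val p) x].
Proof.
split=> [p|p q _ /ltW pq [/= px qx]].
- have [px|px] := pselect (bipr (val p) x).
    exists p; split; first by split; [|left].
    by move=> q [/= qx [->//|e]]; move: qx; rewrite e /= biplE.
  exists (sinv p); split; first by split; [rewrite /= biplE|right].
  by move=> q [/= qx [e|->//]]; case: px; rewrite -e.
(* By computation [px], a statement about [sinv p], says that [x] lies in the left side of [p]. *)
- move: pq; rewrite -Order.le_val => /asboolP /(_ x px).
  by rewrite biplE.
Qed.

End BipartitionPoints.

Lemma bip_image_mono {X Y : Type} {h : X -> Y} (hbij : bijective h) :
  {mono bip_image hbij : p q / p <= q}.
Proof.
move=> p q; apply/asboolP/asboolP => [pq x px|pq]; last exact: image_subset.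
have [y qy /(bij_inj hbij) <- //] : (h @` bipl q) (h x).
by apply: pq; exists x.
Qed.

Theorem theorem5p5 (X : Type) (N : set (bipartition X)) (NC : sinv_closed N)
    (NT : tree_set (subsystem NC))
    (Na : forall x y : X, x <> y ->
      exists p : bipartition X, [/\ N p, bipl p x & bipr p y])
    (Nb : forall O : set (subsystem NC), consistent_orientations (subsystem NC) O ->
      exists x : X, O = [set p | bipr (val p) x])
    (d : Order.disp_t) (T : sepSystemType d) (TT : tree_set T)
    (g : subsystem NC -> T) (giso : tree_set_iso g) :
  exists (h : X -> consistent_orientations T) (hbij : bijective h),
    (forall p : subsystem NC, bip_image hbij (val p) = orientation_bip TT (g p)) /\
    tree_set (subsystem (orientation_bips_closed TT)) /\
    exists a : subsystem NC -> subsystem (orientation_bips_closed TT),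
      (forall p : subsystem NC, val (a p) = bip_image hbij (val p)) /\
      tree_set_iso a.
Proof.
have [[k gK kK] _ ginv] := giso.
have kiso := tree_set_iso_can _ _ gK kK giso.
(* The image under [g] is taken as the preimage under its inverse [k], so that membership
   computes. *)
pose h x : consistent_orientations T := SigSub
  (mem_set (consistent_orientations_preimage _ _ kiso (point_orientation NC x))).
have hE x p : val (h x) (g p) = bipr (val p) x by rewrite /= gK.
have hinj : injective h.
  move=> x y hxy; apply: contrapT => /Na[p [Np]].
  rewrite biplE => px py; apply: px.
  by rewrite -(hE x (subsystem_elt NC Np)) hxy hE.
have hsurj O : exists x, h x = O.
  case: O => O HO.
  (* Pulling [O] back along [g] gives the orientation of some point [x] by (b); pulling back along
     [k] then returns [O]. *)
  have [x Ox] := Nb _ (consistent_orientations_preimage _ _ giso (set_mem HO)).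
  exists x; apply: val_inj => /=; rewrite -Ox.
  by apply/funext => t /=; rewrite kK.
have hbij := inj_surj_bijective _ _ _ hinj hsurj; exists h, hbij.
have hr p : h @` bipr (val p) = orientations_containing (g p).
  apply/seteqP; split=> [_ [x px <-]|O].
    by rewrite /orientations_containing /= gK.
  by have [x <-] := hsurj O; rewrite /orientations_containing /= gK; exists x.
have fgE p : bip_image hbij (val p) = orientation_bip TT (g p).
  (* The left sides reduce to [hr] at [sinv p], whose right side is the left side of [p]. *)
  by apply: bip_eq => /=; rewrite -?ginv -hr.
pose a p : subsystem (orientation_bips_closed TT) :=
  subsystem_elt (orientation_bips_closed TT) (imageT (orientation_bip TT) (g p)).
have aE p : val (a p) = bip_image hbij (val p) by rewrite fgE.
(* Both orders are inclusion of left sides, which images under the bijection [h] preserve and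
   reflect. *)
have amono : {mono a : p q / p <= q}.
  by move=> p q; rewrite -Order.le_val !aE bip_image_mono Order.le_val.
have aiso : tree_set_iso a.
  split=> //.
    apply: inj_surj_bijective => [|[q qN]].
      (* Reflecting the order forces injectivity, by antisymmetry. *)
      by move=> p q e; apply/le_anti; rewrite -!amono e lexx.
    have [s _ sq] := set_mem qN.
    by exists (k s); apply: val_inj; rewrite /= kK.
  by move=> p; apply: val_inj; apply: bip_eq; rewrite /= ?ginv ?sinvK.
split=> //; split; first exact: tree_set_transport aiso NT.
by exists a.
Qed.
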